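(* Let $X$ be a complex Banach space and let $T\in\mathcal{B}(X)$ be a bounded operator with adjoint $T^*\in\mathcal{B}(X^* )$ such that $\partial\sigma(T^{*})\setminus\sigma_p(T^{*})\neq\emptyset$. Then for any $\varepsilon>0$ there exists a rank one operator $F\in\mathcal{B}(X)$ with $\lVert F\rVert<\varepsilon$ such that $T+F$ has an invariant half-space, i.e. there is a half-space $Y$ of $X$ with $(T+F)Y\subseteq Y$.
   Context: $\mathcal{B}(X)$ denotes the algebra of all bounded linear operators on $X$. $X^*$ is the (continuous) dual of $X$ and $T^*: X^*\to X^*$ is the Banach space adjoint of $T$, $(T^*f)(x)=f(Tx)$. For an operator $S$, $\sigma(S)$ is its spectrum, $\partial\sigma(S)$ the topological boundary of $\sigma(S)$ in $\mathbb{C}$, and $\sigma_p(S)$ its point spectrum (the set of eigenvalues). A half-space of $X$ is a norm-closed linear subspace of $X$ of infinite dimension and infinite codimension. *)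

(* Defs.v *)
From HB Require Import structures.
From mathcomp Require Import all_boot all_order all_algebra.
From mathcomp Require Import complex.
From mathcomp Require Import all_classical all_reals all_analysis.

Set Implicit Arguments.
Unset Strict Implicit.
Unset Printing Implicit Defensive.

Import Order.TTheory GRing.Theory Num.Theory.
Import numFieldNormedType.Exports.

Local Open Scope classical_set_scope.
Local Open Scope ring_scope.
Local Open Scope complex_scope.

(* The complex numbers are R[i] for R : realType. The norm of a normed module
   over R[i] takes its values in R[i] (on the nonnegative real axis), and the
   field, seen as a normed space over itself, is R[i]^o. *)

Section BoundedOperators.
Context {R : realType}.
Implicit Types U V W : normedModType R[i].

Definition bounded_linear V W : {pred V -> W} :=
  [pred f : V -> W |
    `[< linear f /\ exists M : R[i], forall x, `|f x| <= M * `|x| >]].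

Lemma bounded_linearP V W (f : V -> W) :
  reflect (linear f /\ exists M : R[i], forall x, `|f x| <= M * `|x|)
          (f \in @bounded_linear V W).
Proof. exact: asboolP. Qed.

Fact bounded_linear_submod_closed V W : submod_closed (@bounded_linear V W).
Proof.
split.
  apply/bounded_linearP; split; first by move=> a x y /=; rewrite scaler0 addr0.
  by exists 0 => x; rewrite mul0r normr0.
move=> a f g /bounded_linearP[fl [M fM]] /bounded_linearP[gl [N gN]].
apply/bounded_linearP; split.
  move=> b x y; rewrite !fctE fl gl !scalerDr !scalerA [a * b]mulrC.
  by rewrite -!addrA; congr (_ + _); rewrite addrCA.
exists (`|a| * M + N) => x; rewrite !fctE (le_trans (ler_normD _ _))//.
by rewrite mulrDl lerD// normrZ -mulrA ler_wpM2l.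
Qed.

HB.instance Definition _ V W := GRing.isSubmodClosed.Build R[i] (V -> W)
  (@bounded_linear V W) (bounded_linear_submod_closed V W).

Record bop V W :=
  Bop { bop_fun :> V -> W; bop_funP : bop_fun \in @bounded_linear V W }.

HB.instance Definition _ V W := [isSub for @bop_fun V W].
HB.instance Definition _ V W := [Choice of bop V W by <:].
HB.instance Definition _ V W :=
  [SubChoice_isSubLmodule of bop V W by <:].

Fact bop_is_linear V W (f : bop V W) : linear f.
Proof. by have /bounded_linearP[] := bop_funP f. Qed.

HB.instance Definition _ V W (f : bop V W) :=
  GRing.isLinear.Build R[i] V W _ f (bop_is_linear f).

Lemma bop_eqP V W (f g : bop V W) : f =1 g -> f = g.
Proof. by move=> fg; apply/val_inj/funext. Qed.

Definition opnorm V W (f : bop V W) : R :=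
  sup [set complex.Re `|f x| | x in [set x : V | `|x| <= 1]].

Lemma normReE V (x : V) : `|x| = (complex.Re `|x|)%:C.
Proof. by rewrite RRe_real// ger0_real. Qed.

Lemma opnorm_has_sup V W (f : bop V W) :
  has_sup [set complex.Re `|f x| | x in [set x : V | `|x| <= 1]].
Proof.
split; first by exists (complex.Re `|f 0|); exists 0 => //=; rewrite normr0.
have /bounded_linearP[_ [M fM]] := bop_funP f.
exists (complex.Re `|M|) => _ [x /= x1 <-].
have : `|f x| <= `|M|.
  have M0 : 0 <= M * `|x| by exact: le_trans (fM x).
  rewrite (le_trans (fM x))// -(ger0_norm M0) normrM normr_id.
  by rewrite ler_piMr.
by rewrite lecE => /andP[].
Qed.

Lemma le_opnorm V W (f : bop V W) x : `|f x| <= (opnorm f)%:C * `|x|.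
Proof.
have [->|x0] := eqVneq x 0; first by rewrite raddf0 !normr0 mulr0.
rewrite -ler_pdivrMr ?normr_gt0// mulrC.
have -> : `|x|^-1 * `|f x| = `|f (`|x|^-1 *: x)|.
  by rewrite linearZ normrZ normfV normr_id.
rewrite normReE lecR; apply: sup_upper_bound; first exact: opnorm_has_sup.
exists (`|x|^-1 *: x) => //=.
by rewrite normrZ normfV normr_id mulVf ?normr_eq0.
Qed.

Lemma opnorm_le V W (f : bop V W) (M : R) :
  (forall x, `|x| <= 1 -> `|f x| <= M%:C) -> opnorm f <= M.
Proof.
move=> fM; apply: ge_sup; first by have [] := opnorm_has_sup f.
by move=> _ [x /= x1 <-]; rewrite -lecR -normReE fM.
Qed.

Lemma opnorm_ge0 V W (f : bop V W) : 0 <= opnorm f.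
Proof.
apply: sup_upper_bound; first exact: opnorm_has_sup.
by exists 0; rewrite /= ?normr0// raddf0 normr0.
Qed.

Fact bop_ler_normD V W (f g : bop V W) :
  (opnorm (f + g))%:C <= (opnorm f)%:C + (opnorm g)%:C.
Proof.
rewrite -rmorphD lecR; apply: opnorm_le => x x1.
rewrite (le_trans (ler_normD (f x) (g x)))// rmorphD/= lerD//.
  by rewrite (le_trans (le_opnorm f x))// ler_piMr// ler0c opnorm_ge0.
by rewrite (le_trans (le_opnorm g x))// ler_piMr// ler0c opnorm_ge0.
Qed.

Fact bop_normrZ V W (a : R[i]) (f : bop V W) :
  (opnorm (a *: f))%:C = `|a| * (opnorm f)%:C.
Proof.
have le b (g : bop V W) : (opnorm (b *: g))%:C <= `|b| * (opnorm g)%:C.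
  have bE : `|b| = (complex.Re `|b|)%:C by rewrite RRe_real// ger0_real.
  rewrite bE -rmorphM lecR; apply: opnorm_le => x x1.
  rewrite [(b *: g) x]/(b *: g x) normrZ rmorphM/= -bE.
  rewrite ler_wpM2l// (le_trans (le_opnorm g x))//.
  by rewrite ler_piMr// ler0c opnorm_ge0.
apply/le_anti; rewrite le/=.
have [->|a0] := eqVneq a 0.
  by rewrite normr0 mul0r ler0c opnorm_ge0.
rewrite mulrC -ler_pdivlMr ?normr_gt0// mulrC -normfV.
by have := le a^-1 (a *: f); rewrite scalerA mulVf// scale1r.
Qed.

Fact bop_normr0_eq0 V W (f : bop V W) : (opnorm f)%:C = 0 -> f = 0.
Proof.
move=> f0; apply: bop_eqP => x; apply/eqP; rewrite -normr_le0.
by rewrite (le_trans (le_opnorm f x))// f0 mul0r.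
Qed.

HB.instance Definition _ V W := Lmodule_isNormed.Build R[i] (bop V W)
  (@bop_ler_normD V W) (@bop_normrZ V W) (@bop_normr0_eq0 V W).

Fact bop_id_subproof V : @idfun V \in @bounded_linear V V.
Proof. by apply/bounded_linearP; split=> //; exists 1 => x; rewrite mul1r. Qed.

Definition bop_id V : bop V V := Bop (bop_id_subproof V).

Fact bop_comp_subproof U V W (g : bop V W) (f : bop U V) :
  g \o f \in @bounded_linear U W.
Proof.
apply/bounded_linearP; split=> [a x y /=|]; first by rewrite !linearP.
exists ((opnorm g)%:C * (opnorm f)%:C) => x /=.
rewrite (le_trans (le_opnorm _ _))// -mulrA ler_wpM2l ?le_opnorm//.
by rewrite ler0c opnorm_ge0.
Qed.

Definition bop_comp U V W (g : bop V W) (f : bop U V) : bop U W :=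
  Bop (bop_comp_subproof g f).

Definition dual V := bop V R[i]^o.
HB.instance Definition _ V := NormedModule.on (dual V).

Fact adjoint_subproof V W (T : bop V W) :
  (fun f : dual W => bop_comp f T : dual V)
    \in @bounded_linear (dual W) (dual V).
Proof.
apply/bounded_linearP; split=> [a f g|]; first exact: bop_eqP.
exists (opnorm T)%:C => f; rewrite -rmorphM lecR; apply: opnorm_le => x x1 /=.
rewrite (le_trans (le_opnorm f _))// mulrC rmorphM/=.
rewrite ler_wpM2r ?ler0c ?opnorm_ge0//.
by rewrite (le_trans (le_opnorm T x))// ler_piMr// ler0c opnorm_ge0.
Qed.

Definition adjoint V W (T : bop V W) : bop (dual W) (dual V) :=
  Bop (adjoint_subproof T).

Definition bop_invertible V (S : bop V V) : Prop :=
  exists B : bop V V, bop_comp B S = bop_id V /\ bop_comp S B = bop_id V.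

Definition spectrum V (S : bop V V) : set R[i]^o :=
  [set z | ~ bop_invertible (z *: bop_id V - S)].

Definition point_spectrum V (S : bop V V) : set R[i]^o :=
  [set z | exists2 v : V, v != 0 & S v = z *: v].

Definition rank_one V W (F : bop V W) : Prop :=
  exists2 y : W, y != 0 & range F = [set z *: y | z in [set: R[i]]].

End BoundedOperators.

Definition boundary (T : topologicalType) (A : set T) : set T :=
  closure A `\` interior A.

Section HalfSpaces.
Context {R : realType}.
Variable V : normedModType R[i].
Implicit Types (Y : set V) (s : seq V).

Definition linear_subspace Y : Prop :=
  Y 0 /\ forall (a : R[i]) x y, Y x -> Y y -> Y (a *: x + y).

Definition linear_span s : set V :=
  [set x | exists c : 'I_(size s) -> R[i], x = \sum_i c i *: s`_i].

Definition finite_dimensional Y : Prop := exists s, Y = linear_span s.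

(* The classes of the elements of s span the quotient of V by Y. *)
Definition finite_codimensional Y : Prop :=
  exists s, forall x, exists2 y, Y y & linear_span s (x - y).

Definition half_space Y : Prop :=
  [/\ linear_subspace Y, closed Y,
      ~ finite_dimensional Y & ~ finite_codimensional Y].

End HalfSpaces.

Definition invariant_subset (V : Type) (S : V -> V) (Y : set V) : Prop :=
  S @` Y `<=` Y.

(* Main.v *)
(** Let lam be a boundary point of the spectrum of the adjoint T* which is not an
eigenvalue of T*. The resolvent of T* blows up near lam, so by condensation of
singularities there are f in X* and mu_n -> lam such that the solutions h_n of
mu_n h_n - T* h_n = f satisfy |h_n| >= n. A pointwise limit of the h_n / |h_n|
along an ultrafilter is a solution of T* g = lam g, hence zero, so a gliding hump
argument extracts a subsequence of (h_n) which has a biorthogonal sequence in X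
together with an arbitrarily small vector x0 on which it is constantly 1. With
F x = f(x) x0 one gets (T + F)* h_n = mu_n h_n along this subsequence, so the
common kernel of the functionals of even rank is invariant under T + F; the
biorthogonal sequence shows that it is a half-space. *)

Require Import Defs.
From mathcomp Require Import all_boot all_order all_algebra.
From mathcomp Require Import complex.
From mathcomp Require Import all_classical all_reals all_analysis.
From mathcomp Require Import ring lra.

Set Implicit Arguments.
Unset Strict Implicit.
Unset Printing Implicit Defensive.

Import Order.TTheory GRing.Theory Num.Theory.
Import numFieldNormedType.Exports.

Local Open Scope classical_set_scope.
Local Open Scope ring_scope.
Local Open Scope complex_scope.

(** * The norm as a real number, so that real arithmetic tactics apply *)

Section RealNorm.
Context {R : realType}.
Implicit Types V W : normedModType R[i].

Definition rnorm V (x : V) : R := complex.Re `|x|.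

Lemma rnormE V (x : V) : `|x| = (rnorm x)%:C.
Proof. exact: normReE. Qed.

Lemma rnorm_ge0 V (x : V) : 0 <= rnorm x.
Proof. by rewrite -ler0c -rnormE. Qed.

Lemma rnorm0 V : rnorm (0 : V) = 0.
Proof. by rewrite /rnorm normr0. Qed.

Lemma rnormD V (x y : V) : rnorm (x + y) <= rnorm x + rnorm y.
Proof. by rewrite -lecR rmorphD/= -!rnormE ler_normD. Qed.

Lemma rnormN V (x : V) : rnorm (- x) = rnorm x.
Proof. by rewrite /rnorm normrN. Qed.

Lemma rnormBC V (x y : V) : rnorm (x - y) = rnorm (y - x).
Proof. by rewrite /rnorm distrC. Qed.

Lemma rnormB V (x y : V) : rnorm (x - y) <= rnorm x + rnorm y.
Proof. by rewrite (le_trans (rnormD _ _))// rnormN. Qed.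

Lemma rnorm_dist V (x y : V) : rnorm x - rnorm y <= rnorm (x - y).
Proof. by rewrite lerBlDr (le_trans _ (rnormD _ _))// subrK. Qed.

Lemma rnormZ V (a : R[i]) (x : V) : rnorm (a *: x) = rnorm (a : R[i]^o) * rnorm x.
Proof.
apply: (@complexI R); rewrite rmorphM/= -!rnormE; exact: normrZ.
Qed.

Lemma rnormM (a b : R[i]^o) : rnorm (a * b : R[i]^o) = rnorm a * rnorm b.
Proof. exact: (rnormZ a b). Qed.

Lemma rnormV (a : R[i]^o) : rnorm (a^-1 : R[i]^o) = (rnorm a)^-1.
Proof.
apply: (@complexI R); rewrite -rnormE fmorphV/= -rnormE; exact: normfV.
Qed.

Lemma rnorm_eq0 V (x : V) : (rnorm x == 0) = (x == 0).
Proof. by rewrite -(inj_eq (@complexI R)) -rnormE normr_eq0. Qed.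

Lemma rnorm_gt0 V (x : V) : (0 < rnorm x) = (x != 0).
Proof. by rewrite lt_def rnorm_eq0 rnorm_ge0 andbT. Qed.

Lemma rnorm_sum V I (r : seq I) (P : pred I) (F : I -> V) :
  rnorm (\sum_(i <- r | P i) F i) <= \sum_(i <- r | P i) rnorm (F i).
Proof.
elim/big_ind2 : _ => //; first by rewrite rnorm0.
by move=> x a y b xa yb; rewrite (le_trans (rnormD _ _))// lerD.
Qed.

Lemma rnorm_bop V W (f : bop V W) : rnorm f = opnorm f.
Proof. by []. Qed.

Lemma rnorm_le_opnorm V W (f : bop V W) x : rnorm (f x) <= opnorm f * rnorm x.
Proof. by rewrite -lecR rmorphM/= -!rnormE le_opnorm. Qed.

Lemma opnorm_le_bound V W (f : bop V W) (M : R) : 0 <= M ->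
  (forall x, rnorm (f x) <= M * rnorm x) -> opnorm f <= M.
Proof.
move=> M0 fM; apply: opnorm_le => x; rewrite !rnormE -[1]/(1%:C) !lecR => x1.
by rewrite (le_trans (fM x))// ler_piMr.
Qed.

Lemma bopD V W (f g : bop V W) x : (f + g) x = f x + g x.
Proof. by []. Qed.

Lemma bopN V W (f : bop V W) x : (- f) x = - f x.
Proof. by []. Qed.

Lemma bopZ V W a (f : bop V W) x : (a *: f) x = a *: f x.
Proof. by []. Qed.

Lemma near_opnorm V W (f : bop V W) : 0 < opnorm f ->
  exists2 u, rnorm u <= 1 & opnorm f / 2 <= rnorm (f u).
Proof.
move=> f0; have [_ [u /= u1 <-] fu] :=
  sup_adherent (divr_gt0 f0 (ltr0n _ 2)) (opnorm_has_sup f).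
exists u; first by move: u1; rewrite rnormE -[1]/(1%:C) lecR.
by move: fu; rewrite -/(opnorm f) => /ltW; apply: le_trans; lra.
Qed.

Lemma bounded_bop V W (f : V -> W) : linear f ->
  (exists M : R, forall x, rnorm (f x) <= M * rnorm x) ->
  exists g : bop V W, g =1 f.
Proof.
move=> fl [M fM]; have fb : f \in @bounded_linear R V W.
  apply/bounded_linearP; split=> //; exists M%:C => x.
  by rewrite !rnormE -rmorphM lecR.
by exists (Bop fb).
Qed.

Lemma rnorm_eq_le V (x y : V) :
  (forall e : R, 0 < e -> rnorm (x - y) <= e) -> x = y.
Proof.
move=> xy; apply/eqP; rewrite -subr_eq0 -rnorm_eq0 eq_le rnorm_ge0 andbT.
by apply/ler_addgt0Pl => e e0; rewrite addr0 xy.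
Qed.

Lemma complex_gt0P (e : R[i]) : 0 < e -> exists2 r : R, 0 < r & e = r%:C.
Proof.
move=> e0; exists (complex.Re e); last by rewrite RRe_real// gtr0_real.
by move: e0; rewrite ltcE => /andP[].
Qed.

Lemma rnorm_real (a : R) : rnorm (a%:C : R[i]^o) = `|a|.
Proof. by rewrite /rnorm [`|_|]normc_def/= expr0n/= addr0 sqrtr_sqr. Qed.

Lemma rnorm_ReIm (z : R[i]^o) : rnorm z <= `|complex.Re z| + `|complex.Im z|.
Proof.
rewrite {1}(complexE z) (le_trans (rnormD (_ : R[i]^o) _))// rnormM !rnorm_real.
by rewrite /rnorm [`|'i|]normc_def/= expr0n/= expr1n add0r sqrtr1 mul1r.
Qed.

Lemma Re_rnorm (z : R[i]^o) : `|complex.Re z| <= rnorm z.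
Proof. by rewrite -lecR -rnormE; exact: normc_ge_Re. Qed.

Lemma Im_rnorm (z : R[i]^o) : `|complex.Im z| <= rnorm z.
Proof.
rewrite /rnorm [X in _ <= complex.Re X]normc_def/= -sqrtr_sqr.
by rewrite ler_wsqrtr// lerDr sqr_ge0.
Qed.

End RealNorm.

(** * Completeness with rates, for Banach spaces, the scalars and duals *)

Section Completeness.
Context {R : realType}.
Implicit Types V W : normedModType R[i].

(** One small term per [e] suffices: the telescoping bounds used with it make [b] nonincreasing, so
    this amounts to convergence to 0. *)
Definition vanishing (b : nat -> R) :=
  (forall n, 0 <= b n) /\ forall e, 0 < e -> exists n, b n <= e.

(* Sequential completeness with an explicit rate: telescoping bounds make the
   sequence Cauchy and control the distance to its limit. *)
Definition rate_complete V := forall (x : nat -> V) (b : nat -> R),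
  vanishing b -> (forall n, rnorm (x n.+1 - x n) <= b n - b n.+1) ->
  exists l, forall n, rnorm (l - x n) <= b n.

Lemma vanishingMr (b : nat -> R) c : 0 <= c -> vanishing b ->
  vanishing (fun n => b n * c).
Proof.
move=> c0 [b0 bv]; split=> [n|e e0]; first by rewrite mulr_ge0.
have c1 : 0 < c + 1 by lra.
have [n bn] := bv _ (divr_gt0 e0 c1); exists n.
rewrite (le_trans (ler_wpM2r c0 bn))// -mulrA ler_piMr ?(ltW e0)//.
by rewrite mulrC ler_pdivrMr// mul1r; lra.
Qed.

Lemma vanishing_geometric (c q : R) : 0 <= c -> 0 <= q < 1 ->
  vanishing (fun n => c * q ^+ n).
Proof.
move=> c0 /andP[q0 q1]; split=> [n|e e0]; first by rewrite mulr_ge0 ?exprn_ge0.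
have := @cvg_geometric R c q; rewrite ger0_norm// => /(_ q1).
move=> /cvgrPdist_le/(_ e e0)[N _ /(_ N (leqnn N))]; rewrite sub0r normrN => cN.
by exists N; apply: le_trans cN; exact: ler_norm.
Qed.

Section Gap.
Variables (V : normedModType R[i]) (x : nat -> V) (b : nat -> R).
Hypothesis bv : vanishing b.
Hypothesis xb : forall n, rnorm (x n.+1 - x n) <= b n - b n.+1.

Lemma vanishing_gap n m : (n <= m)%N -> rnorm (x m - x n) <= b n - b m.
Proof.
move=> /subnKC <-; elim: (m - n)%N => [|k ih].
  by rewrite addn0 !subrr rnorm0.
rewrite addnS -(subrKA (x (n + k)%N)) (le_trans (rnormD _ _))//.
by have := xb (n + k)%N; lra.
Qed.

Lemma vanishing_nincr n m : (n <= m)%N -> b m <= b n.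
Proof. by move=> /vanishing_gap; have := rnorm_ge0 (x m - x n); lra. Qed.

Lemma vanishing_limit l :
  (forall e n, 0 < e -> exists2 m, (n <= m)%N & rnorm (l - x m) <= e) ->
  forall n, rnorm (l - x n) <= b n.
Proof.
move=> lx n; apply/ler_addgt0Pl => e e0; have [m nm lm] := lx e n e0.
rewrite -(subrKA (x m)) (le_trans (rnormD _ _))// lerD//.
by rewrite (le_trans (vanishing_gap nm))//; have := bv.1 m; lra.
Qed.

End Gap.

Lemma complete_rate_complete (X : completeNormedModType R[i]) : rate_complete X.
Proof.
move=> x b bv xb.
have : cvg (x @ \oo).
  apply/cauchy_cvgP/cauchy_exP => _ /complex_gt0P[r r0 ->].
  have [N bN] := bv.2 _ (divr_gt0 r0 (ltr0n _ 2)).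
  exists (x N), N => // n /= Nn.
  rewrite -ball_normE/= rnormE ltcR rnormBC (le_lt_trans (vanishing_gap xb Nn))//.
  by have := bv.1 n; lra.
move=> /cvg_ex[l xl]; exists l; apply: vanishing_limit => // e n e0.
have e0' : 0 < e%:C by rewrite ltcR.
move/cvgrPdist_le : xl => /(_ _ e0')[N _ lN].
exists (maxn n N); first exact: leq_maxl.
by have := lN (maxn n N) (leq_maxr _ _); rewrite /= rnormE lecR.
Qed.

(** The intervals from [x n - b n] to [x n + b n] pairwise meet, so the supremum of the left
    endpoints lies in all of them. *)
Lemma real_rate_complete (x b : nat -> R) :
  (forall n m, (n <= m)%N -> `|x m - x n| <= b n - b m) ->
  (forall n, 0 <= b n) ->
  exists l, forall n, `|l - x n| <= b n.
Proof.
move=> xb b0.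
have xb2 n m : x n - b n <= x m + b m.
  case: (leqP n m) => [/xb|/ltnW/xb]; rewrite ler_norml => /andP[].
    by have := b0 m; have := b0 n; lra.
  by have := b0 m; have := b0 n; lra.
exists (sup (range (fun n => x n - b n))) => n.
have sx : has_sup (range (fun n => x n - b n)).
  split; first by exists (x 0 - b 0); exists 0.
  by exists (x 0 + b 0) => _ [k _ <-]; exact: xb2.
rewrite ler_distl; apply/andP; split.
  by apply: sup_upper_bound => //; exists n.
by apply: ge_sup => [|_ [k _ <-]]; [exact: sx.1|exact: xb2].
Qed.

Lemma scalar_rate_complete : rate_complete (R[i]^o : normedModType R[i]).
Proof.
move=> x b bv xb; have gap := vanishing_gap xb.
have [|u ux] := @real_rate_complete (fun n => complex.Re (x n)) b _ bv.1.
  move=> n m /gap; apply: le_trans; rewrite -raddfB; exact: Re_rnorm.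
have [|v vx] := @real_rate_complete (fun n => complex.Im (x n)) b _ bv.1.
  move=> n m /gap; apply: le_trans; rewrite -raddfB; exact: Im_rnorm.
exists (u +i* v); apply: vanishing_limit => // e n e0.
have [N bN] := bv.2 _ (divr_gt0 e0 (ltr0n _ 2)).
exists (maxn n N); first exact: leq_maxl.
rewrite (le_trans (rnorm_ReIm _))// !raddfB/= (le_trans (lerD (ux _) (vx _)))//.
by have := vanishing_nincr xb (leq_maxr n N); lra.
Qed.

(** The pointwise limit exists by completeness of the scalars; the rate [b n * rnorm v] survives in
    the limit and yields linearity, boundedness and the distance in norm. Completeness of [V] is not
    involved. *)
Lemma dual_rate_complete V : rate_complete (dual V).
Proof.
move=> x b bv xb; have gap := vanishing_gap xb.
have pt v : exists l : R[i]^o, forall n, rnorm (l - x n v) <= b n * rnorm v.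
  apply: scalar_rate_complete; first exact: vanishingMr (rnorm_ge0 v) bv.
  move=> n; rewrite -mulrBl (le_trans (rnorm_le_opnorm (x n.+1 - x n) v))//.
  by rewrite ler_wpM2r ?rnorm_ge0//; exact: xb.
have [l lx] := choice pt.
have llin : linear l.
  move=> a u v; apply: rnorm_eq_le => e e0.
  have C0 : 0 <= rnorm (a *: u + v) + rnorm (a : R[i]^o) * rnorm u + rnorm v.
    by rewrite !addr_ge0 ?mulr_ge0 ?rnorm_ge0.
  have [n bn] := (vanishingMr C0 bv).2 _ e0; apply: le_trans bn.
  have -> : l (a *: u + v) - (a *: l u + l v) =
    (l (a *: u + v) - x n (a *: u + v)) - (a *: (l u - x n u) + (l v - x n v)).
    rewrite (linearP (x n)) scalerBr; set p := a *: l u; set r := a *: x n u.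
    by rewrite [p - r + _]addrACA -[- r - _]opprD opprB addrA subrK.
  rewrite (le_trans (rnormB _ _))//.
  rewrite (le_trans (lerD (lx _ n) (rnormD _ _)))// rnormZ.
  have := lx v n; have := ler_wpM2l (rnorm_ge0 (a : R[i]^o)) (lx u n).
  by nra.
have [|g gl] := bounded_bop llin.
  exists (b 0 + opnorm (x 0)) => v.
  rewrite -(subrK (x 0 v) (l v)) (le_trans (rnormD _ _))// mulrDl lerD//.
  exact: rnorm_le_opnorm.
exists g => n; apply: opnorm_le_bound; first exact: bv.1.
by move=> v; rewrite [(g - x n) v]/(g v - x n v) gl; exact: lx.
Qed.

End Completeness.

(** * Blow-up of the resolvent at the boundary of the spectrum *)

Section BoundaryOfSpectrum.
Context {R : realType}.
Implicit Types V : normedModType R[i].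

(** The lower bound makes preimages unique, so choosing them gives a linear map, of norm at most
    [c^-1]. *)
Lemma invertible_bounded_below V (S : bop V V) (c : R) : 0 < c ->
  (forall x, c * rnorm x <= rnorm (S x)) -> (forall y, exists x, S x = y) ->
  bop_invertible S.
Proof.
move=> c0 Sc /choice[G SG].
have inj x y : S x = S y -> x = y.
  move=> Sxy; apply: rnorm_eq_le => e /ltW; apply: le_trans.
  by rewrite -(ler_pM2l c0) mulr0 (le_trans (Sc _))// raddfB/= Sxy subrr rnorm0.
have Glin : linear G.
  by move=> a x y; apply: inj; rewrite linearP/= !SG.
have [|B BG] := bounded_bop Glin.
  by exists c^-1 => x; rewrite mulrC ler_pdivlMr// mulrC -{2}(SG x).
exists B; split; apply: bop_eqP => x; rewrite /= BG ?SG//.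
by apply: inj; rewrite SG.
Qed.

(* Since mu - S has inverse B, solving z x - S x = y amounts to the fixed point
   equation x = B y - (z - mu) B x. *)
Lemma resolvent_perturbation V (S B : bop V V) (mu z : R[i]^o) :
  rate_complete V ->
  bop_comp B (mu *: bop_id V - S) = bop_id V ->
  bop_comp (mu *: bop_id V - S) B = bop_id V ->
  rnorm (z - mu) * opnorm B < 1 ->
  bop_invertible (z *: bop_id V - S).
Proof.
move=> Vc BS SB q1; set q := _ * opnorm B in q1.
have q0 : 0 <= q by rewrite mulr_ge0 ?rnorm_ge0 ?opnorm_ge0.
have BSx x : B (mu *: x - S x) = x by have := congr1 (fun f : bop V V => f x) BS.
have SBx x : mu *: B x - S (B x) = x by have := congr1 (fun f : bop V V => f x) SB.
pose A x := (z - mu) *: B x.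
have An x : rnorm (A x) <= q * rnorm x.
  by rewrite rnormZ -mulrA ler_wpM2l ?rnorm_ge0// rnorm_le_opnorm.
have AB x y : A x - A y = A (x - y) by rewrite /A raddfB scalerBr.
have zS x : z *: x - S x = (z - mu) *: x + (mu *: x - S x).
  by rewrite scalerBl addrA subrK.
have zSB x : B (z *: x - S x) = x + A x.
  by rewrite zS raddfD/= linearZ/= BSx addrC.
(* By [zSB], the image of [z *: x - S x] under [B] has norm at least [(1 - q) * rnorm x]. The [+ 1]
   avoids a division by zero. *)
apply: (@invertible_bounded_below _ _ ((1 - q) / (opnorm B + 1))).
- by rewrite divr_gt0 ?subr_gt0// ltr_wpDl// opnorm_ge0.
- move=> x; rewrite -[X in _ <= rnorm X]/(z *: x - S x).
  rewrite mulrAC ler_pdivrMr; last by rewrite ltr_wpDl// opnorm_ge0.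
  have := rnorm_le_opnorm B (z *: x - S x); rewrite zSB.
  have := rnorm_dist x (- A x); rewrite opprK rnormN.
  have := An x; have := rnorm_ge0 (z *: x - S x); nra.
(* Picard iteration from 0: successive differences shrink by the factor [q], and [c] sums the
   geometric series. *)
- move=> y; pose x := fix x n := if n is m.+1 then B y - A (x m) else 0.
  pose c := opnorm B * rnorm y / (1 - q).
  have c0 : 0 <= c.
    by rewrite divr_ge0 ?mulr_ge0 ?rnorm_ge0 ?opnorm_ge0// subr_ge0 ltW.
  have q01 : 0 <= q < 1 by rewrite q0.
  have xq n : rnorm (x n.+1 - x n) <= q ^+ n * (opnorm B * rnorm y).
    elim: n => [|n ih].
      rewrite expr0 mul1r /= /A raddf0 scaler0 !subr0; exact: rnorm_le_opnorm.
    have -> : x n.+2 - x n.+1 = - (A (x n.+1) - A (x n)).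
      by rewrite -[x n.+2]/(B y - A (x n.+1)) {2}[x n.+1]/(B y - A (x n)) !opprB addrC addrA subrK.
    by rewrite rnormN AB (le_trans (An _))// exprS -mulrA ler_wpM2l.
  have [|l xl] := Vc x (fun n => c * q ^+ n) (vanishing_geometric c0 q01).
    move=> n; rewrite (le_trans (xq n))// exprS /c.
    rewrite le_eqVlt; apply/orP; left; apply/eqP; field.
    by rewrite subr_eq0 eq_sym lt_eqF.
  have lfix : l = B y - A l.
    apply: rnorm_eq_le => e e0.
    have [n cn] := (vanishing_geometric c0 q01).2 _ (divr_gt0 e0 (ltr0n _ 2)).
    rewrite -(subrKA (x n.+1)) (le_trans (rnormD _ _))//.
    rewrite [X in _ + rnorm X](_ : _ = A (l - x n)); last first.
      by rewrite -AB /= opprB [LHS]addrC addrA subrK.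
    have := An (l - x n); have := xl n; have := xl n.+1; rewrite exprS.
    have : 0 <= c * q ^+ n by rewrite mulr_ge0 ?exprn_ge0.
    have := rnorm_ge0 (l - x n); nra.
  have lA : l + A l = B y by rewrite {1}lfix subrK.
  by exists l; rewrite -[LHS]/(z *: l - S l) -[LHS]SBx zSB lA SBx.
Qed.

Lemma closure_rnormP (A : set R[i]^o) z : closure A z ->
  forall d : R, 0 < d -> exists2 w, A w & rnorm (w - z) < d.
Proof.
move=> Az d d0; have d0' : 0 < d%:C by rewrite ltcR.
have [w [Aw]] := Az _ (nbhsx_ballx z d%:C d0').
by rewrite -ball_normE/= rnormE ltcR rnormBC => wz; exists w.
Qed.

Lemma not_interior_rnormP (A : set R[i]^o) z : ~ interior A z ->
  forall d : R, 0 < d -> exists2 w, ~ A w & rnorm (w - z) < d.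
Proof.
move=> Az d d0; apply: contrapT => nw; apply: Az.
have d0' : 0 < d%:C by rewrite ltcR.
apply/nbhs_ballP; exists d%:C => // w.
rewrite -ball_normE/= rnormE ltcR rnormBC => wz.
by apply: contrapT => Aw; apply: nw; exists w.
Qed.

(** Both spectral and non-spectral points lie arbitrarily close to [lam]. A bound on the inverses
    near [lam] would make the perturbation lemma apply at a spectral point. *)
Lemma resolvent_blowup V (S : bop V V) (lam : R[i]^o) : rate_complete V ->
  boundary (spectrum S) lam -> forall d M : R, 0 < d ->
  exists (mu : R[i]^o) (B : bop V V), [/\ rnorm (mu - lam) < d,
    bop_comp B (mu *: bop_id V - S) = bop_id V,
    bop_comp (mu *: bop_id V - S) B = bop_id V & M < opnorm B].
Proof.
move=> Vc [lamc lami] d M d0; apply: contrapT => nB.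
(* Two points within [r] of [lam] are less than [2 * r] apart, so [rnorm (z - mu) * opnorm B] is at
   most 1/2. *)
pose r := Num.min d (4 * (`|M| + 1))^-1.
have M1 : 0 < `|M| + 1 by rewrite ltr_wpDl.
have r0 : 0 < r by rewrite lt_min d0 invr_gt0 mulr_gt0.
have [z zs zr] := closure_rnormP lamc r0.
have [mu /contrapT[B [BS SB]] mur] := not_interior_rnormP lami r0.
apply: zs; apply: (resolvent_perturbation Vc BS SB).
have BM : opnorm B <= `|M| + 1.
  rewrite leNgt; apply/negP => MB; apply: nB; exists mu, B; split=> //.
    by rewrite (lt_le_trans mur)// ge_min lexx.
  by rewrite (le_lt_trans _ MB)// (le_trans (ler_norm _))// lerDl.
have zm : rnorm (z - mu) <= 2 * (4 * (`|M| + 1))^-1.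
  rewrite -(subrKA lam) (le_trans (rnormD _ _))// [rnorm (lam - _)]rnormBC.
  have : r <= (4 * (`|M| + 1))^-1 by rewrite ge_min lexx orbT.
  by lra.
rewrite (le_lt_trans (ler_pM (rnorm_ge0 _) (opnorm_ge0 _) zm BM))//.
by rewrite invfM mulrA divfK ?gt_eqF//; lra.
Qed.

(* One of x + u and x - u has an image of norm at least that of u. *)
Lemma push_norm V W (A : bop V W) (x u : V) :
  exists2 y, rnorm (y - x) <= rnorm u & rnorm (A u) <= rnorm (A y).
Proof.
have [Ap|Ap] := leP (rnorm (A u)) (rnorm (A (x + u))).
  by exists (x + u) => //; rewrite addrC addKr.
exists (x - u); first by rewrite addrC addKr rnormN.
have : rnorm (2 *: A u) <= rnorm (A (x + u)) + rnorm (A (x - u)).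
  apply: le_trans (rnormB _ _).
  rewrite -raddfB opprB [x + u]addrC addrACA subrr addr0.
  by rewrite -mulr2n raddfMn/= scaler_nat.
rewrite rnormZ (_ : rnorm (2 : R[i]^o) = 2); first by lra.
by rewrite -[X in rnorm X](rmorph_nat (real_complex R)) rnorm_real ger0_norm.
Qed.

(** Step [n] moves the current vector by at most [4^-1 ^+ n] so that its image under [A n] has norm
    at least [4^-1 ^+ n * opnorm (A n) / 2]. All later moves total at most a third of [4^-1 ^+ n],
    so 1/2 - 1/3 = 1/6 of [4^-1 ^+ n * opnorm (A n)] remains, whence the factor 6. *)
Lemma condensation V W (A : nat -> bop V W) : rate_complete V ->
  (forall n, n%:R * 6 * 4 ^+ n < opnorm (A n)) ->
  exists f, forall n, n%:R <= rnorm (A n f).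
Proof.
move=> Vc Abig.
have A0 n : 0 < opnorm (A n).
  by rewrite (le_lt_trans _ (Abig n))// !mulr_ge0 ?exprn_ge0.
have step (p : nat * V) : exists y, rnorm (y - p.2) <= 4^-1 ^+ p.1 /\
    4^-1 ^+ p.1 * (opnorm (A p.1) / 2) <= rnorm (A p.1 y).
  have [u u1 Au] := near_opnorm (A0 p.1).
  pose t : R[i] := (4^-1 ^+ p.1)%:C.
  have tn : rnorm (t : R[i]^o) = 4^-1 ^+ p.1.
    by rewrite rnorm_real ger0_norm// exprn_ge0 ?invr_ge0.
  have [y yx Ay] := push_norm (A p.1) p.2 (t *: u).
  exists y; split.
    by rewrite (le_trans yx)// rnormZ tn ler_piMr// exprn_ge0 ?invr_ge0.
  by rewrite (le_trans _ Ay)// linearZ/= rnormZ tn ler_wpM2l// exprn_ge0 ?invr_ge0.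
have [F FP] := choice step.
pose x := fix x n := if n is m.+1 then F (m, x m) else 0.
have q01 : 0 <= (4^-1 : R) < 1 by lra.
have c0 : 0 <= (4 / 3 : R) by lra.
have [|f xf] := Vc x (fun n => 4 / 3 * 4^-1 ^+ n) (vanishing_geometric c0 q01).
  move=> n; have [/= + _] := FP (n, x n); move/le_trans; apply.
  by rewrite exprS; lra.
exists f => n; have [_ /= An] := FP (n, x n).
have := rnorm_dist (A n (x n.+1)) (A n (x n.+1 - f)).
have -> : A n (x n.+1) - A n (x n.+1 - f) = A n f by rewrite raddfB/= subKr.
have := xf n.+1; rewrite rnormBC => /(ler_wpM2l (opnorm_ge0 (A n))).
move/(le_trans (rnorm_le_opnorm _ _)).
rewrite /= exprS.
have : n%:R <= 4^-1 ^+ n * opnorm (A n) / 6.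
  by rewrite ler_pdivlMr// exprVn [leRHS]mulrC ler_pdivlMr ?exprn_gt0// ltW.
move: An => /=; lra.
Qed.

Lemma resolvent_orbit V (S : bop V V) (lam : R[i]^o) : rate_complete V ->
  boundary (spectrum S) lam ->
  exists (f : V) (mu : nat -> R[i]^o) (h : nat -> V), [/\ f != 0,
    forall n, rnorm (mu n - lam) < n.+1%:R^-1,
    forall n, mu n *: h n - S (h n) = f & forall n, n%:R <= rnorm (h n)].
Proof.
move=> Vc lamb.
have /choice[m mP] n : exists p : R[i]^o * bop V V,
    [/\ rnorm (p.1 - lam) < n.+1%:R^-1,
    bop_comp (p.1 *: bop_id V - S) p.2 = bop_id V &
    n%:R * 6 * 4 ^+ n < opnorm p.2].
  have n0 : 0 < n.+1%:R^-1 :> R by rewrite invr_gt0.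
  have [mu [B [? _ ? ?]]] := resolvent_blowup Vc lamb (n%:R * 6 * 4 ^+ n) n0.
  by exists (mu, B).
have [|f fP] := @condensation _ _ (fun n => (m n).2) Vc.
  by move=> n; have [] := mP n.
exists f, (fun n => (m n).1), (fun n => (m n).2 f); split=> //.
- apply/eqP => f0; have := fP 1; rewrite f0 raddf0 rnorm0; lra.
- by move=> n; have [] := mP n.
- by move=> n; have [_ + _] := mP n => /(congr1 (fun g : bop V V => g f)).
Qed.

End BoundaryOfSpectrum.

(** * Pointwise limits of the normalized functionals along an ultrafilter *)

Section WeakStarNull.
Context {R : realType}.

Lemma shifted_adjointE (X : normedModType R[i]) (T : bop X X) (a : R[i])
    (h f : dual X) :
  a *: h - adjoint T h = f -> forall x, f x = a * h x - h (T x).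
Proof. by move=> <- x; rewrite bopD bopN bopZ. Qed.

Lemma ultra_bounded_real (U : set_system nat) (z : nat -> R) (K : R) :
  UltraFilter U -> (forall n, `|z n| <= K) ->
  exists l, forall e, 0 < e -> U [set n | `|l - z n| <= e].
Proof.
move=> UU zK.
have Uz : U (z @^-1` `[- K, K]%classic).
  by apply: filterE => n; rewrite /= in_itv/= -ler_norml.
have [l [_ zl]] := @segment_compact R (- K) K (z @ U) _ Uz.
exists l => e e0; have [//|Ue] := in_ultra_setVsetC [set n | `|l - z n| <= e] UU.
have [r [/= lr]] := zl [set r | ~ `|l - r| <= e] _ Ue (nbhsx_ballx l e e0).
by move=> /ltW.
Qed.

Lemma ultra_bounded (U : set_system nat) (z : nat -> R[i]^o) (K : R) :
  UltraFilter U -> (forall n, rnorm (z n) <= K) ->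
  exists l, forall e, 0 < e -> U [set n | rnorm (l - z n) <= e].
Proof.
move=> UU zK.
have [n|a za] := ultra_bounded_real (z := fun n => complex.Re (z n)) (K := K) UU.
  exact: le_trans (Re_rnorm _) (zK n).
have [n|b zb] := ultra_bounded_real (z := fun n => complex.Im (z n)) (K := K) UU.
  exact: le_trans (Im_rnorm _) (zK n).
exists (a +i* b) => e e0; have e2 : 0 < e / 2 by lra.
apply: filterS (filterI (za _ e2) (zb _ e2)) => n /= [na nb].
by rewrite (le_trans (rnorm_ReIm _))// !raddfB/=; lra.
Qed.

(** Used with [a], [b] the limits at [T x] and [x], with [ga], [gb] their approximations by one
    normalized functional, and with [c] the normalized right-hand side at [x]. *)
Lemma eigen_estimate (a b ga gb la mu c : R[i]^o) (K d : R) :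
  ga = mu * gb - c -> rnorm (a - ga) <= d -> rnorm (b - gb) <= d ->
  rnorm (mu - la) <= d -> rnorm c <= d -> rnorm gb <= K ->
  rnorm (a - la * b : R[i]^o) <= d * (rnorm la + K + 2).
Proof.
move=> -> ad bd md cd gK.
have -> : a - la * b =
    (a - (mu * gb - c)) + ((mu - la) * gb - c) - la * (b - gb) by ring.
rewrite (le_trans (rnormB _ _))// (le_trans (lerD (rnormD _ _) (lexx _)))//.
rewrite (le_trans (lerD (lerD ad (rnormB _ _)) (lexx _)))// !rnormM.
have := ler_pM (rnorm_ge0 _) (rnorm_ge0 _) md gK.
have := ler_wpM2l (rnorm_ge0 la) bd.
lra.
Qed.

(* Along an ultrafilter the normalized functionals converge pointwise; the limit
   solves the eigenvalue equation of the adjoint, so it vanishes. *)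
Lemma approx_eigen_null (X : normedModType R[i]) (T : bop X X) (lam : R[i]^o)
    (f : dual X) (mu : nat -> R[i]^o) (h : nat -> dual X) :
  ~ point_spectrum (adjoint T) lam ->
  (forall n, rnorm (mu n - lam) < n.+1%:R^-1) ->
  (forall n, mu n *: h n - adjoint T (h n) = f) ->
  (forall n, n%:R <= rnorm (h n)) ->
  forall k (w : nat -> X) (t : R) (m : nat), 0 < t ->
  exists2 n, (m <= n)%N &
    forall j, (j < k)%N -> rnorm (h n (w j)) <= t * rnorm (h n).
Proof.
move=> lamT muP hf hn.
have [U [UU Uoo]] := ultraFilterLemma (eventually_filter : ProperFilter \oo).
pose g n x : R[i]^o := ((rnorm (h n))^-1)%:C * h n x.
have gE n x : rnorm (g n x) = (rnorm (h n))^-1 * rnorm (h n x).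
  by rewrite rnormM rnorm_real ger0_norm// invr_ge0 rnorm_ge0.
have g1 x n : rnorm (g n x) <= rnorm x.
  (* If [h n] is zero, the convention that 0 has inverse 0 makes [g n] zero as well. *)
  rewrite gE; have [->|h0] := eqVneq (rnorm (h n)) 0.
    by rewrite invr0 mul0r rnorm_ge0.
  rewrite ler_pdivrMl; first exact: rnorm_le_opnorm.
  by rewrite lt_def h0 rnorm_ge0.
have /choice[l lg] x : exists l, forall e, 0 < e ->
    U [set n | rnorm (l - g n x) <= e] := ultra_bounded UU (g1 x).
have llin : linear l.
  move=> a u v; apply: rnorm_eq_le => e e0.
  have C0 : 0 < rnorm (a : R[i]^o) + 2 by rewrite ltr_wpDl ?rnorm_ge0.
  have e1 : 0 < e / (rnorm (a : R[i]^o) + 2) by rewrite divr_gt0.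
  have [n /= [[nuv nu] nv]] := filter_ex
    (filterI (filterI (lg (a *: u + v) _ e1) (lg u _ e1)) (lg v _ e1)).
  have -> : l (a *: u + v) - (a *: l u + l v) = (l (a *: u + v) - g n (a *: u + v))
      - (a *: (l u - g n u) + (l v - g n v)).
    have -> : g n (a *: u + v) = a *: g n u + g n v.
      by rewrite /g (linearP (h n))/= mulrDr; congr (_ + _); exact: mulrCA.
    rewrite scalerBr; set p := a *: l u; set r := a *: g n u.
    by rewrite [p - r + _]addrACA -[- r - _]opprD opprB addrA subrK.
  rewrite (le_trans (rnormB _ _))// (le_trans (lerD nuv (rnormD _ _)))// rnormZ.
  have := ler_wpM2l (rnorm_ge0 (a : R[i]^o)) nu.
  have : e = e / (rnorm (a : R[i]^o) + 2) * (rnorm (a : R[i]^o) + 2).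
    by rewrite divfK// gt_eqF.
  by lra.
have [|phi phiE] := bounded_bop llin.
  exists 1 => x; rewrite mul1r; apply/ler_addgt0Pl => e e0.
  have [n /= nx] := filter_ex (lg x _ e0).
  by rewrite -(subrK (g n x) (l x)) (le_trans (rnormD _ _))// lerD.
have lT x : l (T x) = lam * l x :> R[i]^o.
  apply: rnorm_eq_le => e e0.
  have C0 : 0 < rnorm lam + rnorm x + 2 by rewrite ltr_wpDl// addr_ge0 ?rnorm_ge0.
  have [d d0 ed] : exists2 d, 0 < d & e = d * (rnorm lam + rnorm x + 2).
    by exists (e / (rnorm lam + rnorm x + 2)); rewrite ?divr_gt0// divfK// gt_eqF.
  (* An index beyond [N] exceeds both [d^-1] and [rnorm (f x) / d], which makes [mu n - lam] and the
     normalized value of [f] at [x] at most [d]. *)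
  pose N := (Num.truncn (d^-1) + Num.truncn (rnorm (f x) / d)).+1.
  have UN : U [set n | (N <= n)%N] by apply: Uoo; exists N.
  have [n /= [[nTx nx] Nn]] := filter_ex
    (filterI (filterI (lg (T x) _ d0) (lg x _ d0)) UN).
  have arch (r : R) : (Num.truncn r < N)%N -> r <= n%:R.
    move=> rN; rewrite ltW// (lt_le_trans (truncnS_gt r))// ler_nat.
    exact: leq_trans Nn.
  have n0 : 0 < n%:R :> R by rewrite ltr0n (leq_trans _ Nn).
  have h0 : 0 < rnorm (h n) := lt_le_trans n0 (hn n).
  have mun : rnorm (mu n - lam) <= d.
    rewrite (le_trans (ltW (muP n)))// -[d]invrK lef_pV2 ?posrE//.
      by rewrite (le_trans (arch _ _)) ?ler_nat// /N ltnS leq_addr.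
    by rewrite invr_gt0.
  have fn : (rnorm (h n))^-1 * rnorm (f x) <= d.
    rewrite ler_pdivrMl// -ler_pdivrMr// (le_trans _ (hn n))//.
    by rewrite arch// /N ltnS leq_addl.
  have gT : g n (T x) = mu n * g n x - ((rnorm (h n))^-1)%:C * f x.
    by rewrite (shifted_adjointE (hf n)) /g; ring.
  rewrite ed; apply: (eigen_estimate gT nTx nx mun) => //.
  by rewrite rnormM rnorm_real ger0_norm// invr_ge0 rnorm_ge0.
have phi_eigen : adjoint T phi = lam *: phi.
  apply: bop_eqP => x; apply: (etrans (phiE (T x))); apply: (etrans (lT x)).
  exact: (congr1 (fun v => lam * v) (esym (phiE x))).
have phi0 : phi = 0.
  by apply: contrapT => /eqP phi0; apply: lamT; exists phi.
have l0 x : l x = 0 by rewrite -phiE phi0.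
move=> k w t m t0.
have Uk : U [set n | forall j, (j < k)%N -> rnorm (g n (w j)) <= t].
  elim: k => [|k ih]; first by apply: filterE => n j.
  apply: filterS (filterI ih (lg (w k) _ t0)) => n /= [nk nwk] j.
  rewrite ltnS leq_eqVlt => /orP[/eqP->|/nk//].
  by move: nwk; rewrite l0 sub0r rnormN.
(* Taking [m.+1] rather than [m] makes [n] positive, hence [h n] nonzero, so that the normalization
   can be undone. *)
have Um : U [set n | (m.+1 <= n)%N] by apply: Uoo; exists m.+1.
have [n /= [nk mn]] := filter_ex (filterI Uk Um); exists n; first exact: ltnW.
move=> j /nk; rewrite gE ler_pdivrMl 1?mulrC//.
by rewrite (lt_le_trans _ (hn n))// ltr0n (leq_ltn_trans _ mn).
Qed.

End WeakStarNull.

(** * One step of the gliding hump construction *)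

Section GlidingHump.
Context {R : realType}.

Lemma rnorm_dual_le (X : normedModType R[i]) (f : dual X) x :
  rnorm (f x) <= rnorm f * rnorm x.
Proof. exact: rnorm_le_opnorm. Qed.

Variables (X : normedModType R[i]) (h : nat -> dual X).
Hypothesis h_large : forall n, n%:R <= rnorm (h n).
Hypothesis h_null : forall k (w : nat -> X) (t : R) m, 0 < t ->
  exists2 n, (m <= n)%N &
    forall j, (j < k)%N -> rnorm (h n (w j)) <= t * rnorm (h n).

(** Padding [w] with zeros lets successive stages be compared at every index, a newly added vector
    counting as a small change of 0. *)
Definition biorthogonal k (N : nat -> nat) (w : nat -> X) :=
  (forall i j, (i < k)%N -> (j < k)%N -> h (N i) (w j) = (i == j)%:R) /\
  (forall j, (k <= j)%N -> w j = 0).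

(** Take [u] almost norming for [h n] and subtract its biorthogonal projection onto the [w j]. As
    [h n] is relatively small on the [w j], a quarter of its norm survives; rescaling to value 1
    then gives a vector of norm at most [4 * C / rnorm (h n)]. *)
Lemma hump_vector k N w (d : R) : biorthogonal k N w -> 0 < d ->
  exists n v, [/\ forall i, (i < k)%N -> h (N i) v = 0, h n v = 1,
    rnorm v <= d & forall j, (j < k)%N -> rnorm (h n (w j)) * rnorm v <= d].
Proof.
move=> [Nw _] d0.
pose D := \sum_(j < k) rnorm (h (N j)).
pose C := 1 + \sum_(j < k) rnorm (h (N j)) * rnorm (w j).
have D0 : 0 <= D by apply: sumr_ge0 => j _; exact: rnorm_ge0.
have C0 : 0 < C by rewrite ltr_pwDl// sumr_ge0// => j _; rewrite mulr_ge0 ?rnorm_ge0.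
(* The first bound serves the products [rnorm (h n (w j)) * rnorm v]; the second keeps the loss due
   to the projection below a quarter of [rnorm (h n)]. *)
pose t := Num.min (d / (4 * C)) (4 * (D + 1))^-1.
have t0 : 0 < t by rewrite lt_min divr_gt0 ?mulr_gt0 ?invr_gt0 ?mulr_gt0// ltr_wpDl.
have [n mn nw] := h_null k w (Num.truncn (4 * C / d)).+1 t0.
have Hm : 4 * C / d <= rnorm (h n).
  by rewrite (le_trans _ (h_large n))// ltW// (lt_le_trans (truncnS_gt _))// ler_nat.
have H0 : 0 < rnorm (h n) by rewrite (lt_le_trans _ Hm)// !mulr_gt0 ?invr_gt0.
have [u u1 hu] := near_opnorm H0.
have hNu j : rnorm (h (N j) u) <= rnorm (h (N j)).
  by apply: (le_trans (rnorm_dual_le _ _)); exact: ler_piMr (rnorm_ge0 _) u1.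
pose u' := u - \sum_(j < k) h (N j) u *: w j.
have u'C : rnorm u' <= C.
  rewrite (le_trans (rnormB _ _))// lerD// (le_trans (rnorm_sum _ _ _))// ler_sum// => j _.
  by rewrite rnormZ; exact: ler_pM (rnorm_ge0 _) (rnorm_ge0 _) (hNu j) (lexx _).
have Nu' i : (i < k)%N -> h (N i) u' = 0.
  move=> ik; rewrite /u' raddfB raddf_sum/= (bigD1 (Ordinal ik))//= big1 ?addr0.
    by rewrite linearZ/= Nw// eqxx [_ *: _]mulr1 subrr.
  move=> j ji; rewrite linearZ/= Nw// [_ == _](_ : _ = false) ?scaler0//.
  by apply/negbTE; rewrite eq_sym.
have nu' : rnorm (h n) / 4 <= rnorm (h n u').
  rewrite /u' raddfB raddf_sum/= (le_trans _ (rnorm_dist _ _))//.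
  have : rnorm (\sum_(j < k) h n (h (N j) u *: w j)) <= D * (t * rnorm (h n)).
    rewrite (le_trans (rnorm_sum _ _ _))// /D mulr_suml ler_sum// => j _.
    rewrite linearZ/= rnormZ.
    exact: ler_pM (rnorm_ge0 _) (rnorm_ge0 _) (hNu j) (nw j (ltn_ord j)).
  have : D * t <= 4^-1.
    have t1 : t <= (4 * (D + 1))^-1 by rewrite ge_min lexx orbT.
    rewrite (le_trans (ler_wpM2l D0 t1))// invfM mulrCA ler_piMr//.
    by rewrite ler_pdivrMr ?mul1r ?ltr_wpDl// lerDl.
  move=> /(ler_wpM2r (ltW H0)); rewrite -mulrA; move: hu; rewrite -[opnorm _]/(rnorm (h n)); lra.
have c0 : 0 < rnorm (h n u') by rewrite (lt_le_trans _ nu')// divr_gt0.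
pose v := (h n u')^-1 *: u'.
have v4 : rnorm v <= 4 * C / rnorm (h n).
  rewrite rnormZ rnormV ler_pdivrMl// (le_trans u'C)// mulrA ler_pdivlMr//.
  have := ler_wpM2l (ltW C0) nu'; lra.
exists n, v; split.
- by move=> i ik; rewrite linearZ/= Nu'// scaler0.
- rewrite linearZ/=; apply: mulVf; by rewrite -rnorm_gt0.
- by rewrite (le_trans v4)// ler_pdivrMr// [leRHS]mulrC -ler_pdivrMr.
- move=> j jk; rewrite (le_trans (ler_pM (rnorm_ge0 _) (rnorm_ge0 _) (nw j jk) v4))//.
  have t1 : t <= d / (4 * C) by rewrite ge_min lexx.
  by rewrite mulrACA divff ?gt_eqF// mulr1 -ler_pdivlMr ?mulr_gt0.
Qed.

(** Subtracting [h n (w j) *: v] from [w j] makes the new functional vanish there and changes no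
    earlier value, since the earlier functionals vanish at [v]. *)
Lemma biorthogonal_extend k N w (d : R) : biorthogonal k N w -> 0 < d ->
  exists N' w', [/\ biorthogonal k.+1 N' w', forall i, (i < k)%N -> N' i = N i
    & forall j, rnorm (w' j - w j) <= d].
Proof.
move=> Nw d0; have [n [v [Nv nv vd wvd]]] := hump_vector Nw d0.
case: Nw => Nw w0.
exists (fun i => if (i < k)%N then N i else n).
exists (fun j => if (j < k)%N then w j - h n (w j) *: v else if j == k then v else 0).
split; last 2 first.
- by move=> i ->.
- move=> j; have [jk|kj] := ltnP j k.
    by rewrite addrC addKr rnormN rnormZ wvd.
  by rewrite w0// subr0; case: ifP => // _; rewrite rnorm0 ltW.
split=> [i j|j kj].
  rewrite !ltnS; case: (ltngtP i k) => // ik _; case: (ltngtP j k) => // jk _.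
  - by rewrite raddfB/= linearZ/= Nv// scaler0 subr0 Nw.
  - by rewrite Nv// jk ltn_eqF.
  - by rewrite raddfB/= linearZ/= nv [_ *: _]mulr1 subrr ik gtn_eqF.
  - by rewrite nv ik jk eqxx.
by rewrite ltnNge ltnW//= gtn_eqF.
Qed.

End GlidingHump.

(** * The infinite biorthogonal system and its independence *)

Section BiorthogonalSystem.
Context {R : realType}.

Lemma dual_limit (X : normedModType R[i]) (phi : dual X) (x : nat -> X) (l : X)
    (a : R[i]^o) (c q : R) (k0 : nat) :
  0 <= c -> 0 <= q < 1 -> (forall k, rnorm (l - x k) <= c * q ^+ k) ->
  (forall k, (k0 <= k)%N -> phi (x k) = a) -> phi l = a.
Proof.
move=> c0 q01 lx phix; apply: rnorm_eq_le => e e0.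
have C0 : 0 <= rnorm phi by exact: rnorm_ge0.
have [n cn] := (vanishingMr C0 (vanishing_geometric c0 q01)).2 _ e0.
apply: le_trans cn; rewrite -(phix (n + k0)%N) ?leq_addl//.
have -> : phi l - phi (x (n + k0)%N) = phi (l - x (n + k0)%N) by rewrite raddfB.
rewrite (le_trans (rnorm_dual_le _ _))// mulrC.
apply: ler_pM => //; first exact: rnorm_ge0.
move/andP: q01 => [q0 q1]; rewrite (le_trans (lx _))// ler_wpM2l//.
by rewrite exprD ler_piMr ?exprn_ge0// exprn_ile1// ltW.
Qed.

Lemma biorthogonal_system (X : normedModType R[i]) (h : nat -> dual X) (eta : R) :
  rate_complete X -> 0 < eta ->
  (forall n, n%:R <= rnorm (h n)) ->
  (forall k (w : nat -> X) (t : R) m, 0 < t ->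
    exists2 n, (m <= n)%N &
      forall j, (j < k)%N -> rnorm (h n (w j)) <= t * rnorm (h n)) ->
  exists (m : nat -> nat) (w : nat -> X) (x0 : X),
    [/\ forall i j, h (m i) (w j) = (i == j)%:R,
      forall i, h (m i) x0 = 1 & rnorm x0 <= eta].
Proof.
move=> Xc eta0 h_large h_null.
(* Stage [k] changes [k.+1] vectors by at most [d k] each, so their sum moves by at most
   [eta * 2^-1 ^+ k.+1], which telescopes. *)
pose d k : R := eta * 2^-1 ^+ k / 2 / k.+1%:R.
have d0 k : 0 < d k by rewrite !mulr_gt0 ?invr_gt0 ?exprn_gt0.
have /choice[F FP] (p : nat * ((nat -> nat) * (nat -> X))) :
    exists q : (nat -> nat) * (nat -> X), biorthogonal h p.1 p.2.1 p.2.2 ->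
    [/\ biorthogonal h p.1.+1 q.1 q.2, forall i, (i < p.1)%N -> q.1 i = p.2.1 i
      & forall j, rnorm (q.2 j - p.2.2 j) <= d p.1].
  have [bp|nbp] := pselect (biorthogonal h p.1 p.2.1 p.2.2); last by exists p.2.
  have [N' [w' ?]] := biorthogonal_extend h_large h_null bp (d0 p.1).
  by exists (N', w').
pose st := fix st k := if k is k'.+1 then F (k', st k')
  else ((fun=> 0%N), (fun=> 0 : X)).
have bi k : biorthogonal h k (st k).1 (st k).2.
  by elim: k => [|k ih]; [split|have [] := FP (k, st k) ih].
have stN k i : (i < k)%N -> (st k.+1).1 i = (st k).1 i.
  by have [_ + _] := FP (k, st k) (bi k); apply.
have stw k j : rnorm ((st k.+1).2 j - (st k).2 j) <= d k.
  by have [_ _] := FP (k, st k) (bi k); apply.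
pose m i := (st i.+1).1 i.
have mE i k : (i < k)%N -> (st k).1 i = m i.
  elim: k => // k ih; rewrite ltnS leq_eqVlt => /orP[/eqP->//|ik].
  by rewrite stN// ih.
have q01 : 0 <= (2^-1 : R) < 1 by lra.
have eta0' := ltW eta0.
have dE k : k.+1%:R * d k = eta * 2^-1 ^+ k - eta * 2^-1 ^+ k.+1.
  by rewrite mulrC divfK ?pnatr_eq0// exprS; lra.
have d_le k : d k <= eta * 2^-1 ^+ k - eta * 2^-1 ^+ k.+1.
  by rewrite -dE ler_peMl ?(ltW (d0 k))// ler1n.
have /choice[w wP] j : exists l, forall k, rnorm (l - (st k).2 j) <= eta * 2^-1 ^+ k.
  apply: (Xc _ _ (vanishing_geometric eta0' q01)) => k.
  exact: le_trans (stw k j) (d_le k).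
(* The vector [x0] is the limit of these sums, on which each [h (m i)] is 1 once [k] exceeds [i]. As
   [x 0] is the empty sum, the rate at index 0 bounds [x0] by [eta]. *)
pose x k := \sum_(j < k) (st k).2 j.
have [|x0 x0P] := Xc x _ (vanishing_geometric eta0' q01).
  move=> k; have -> : x k.+1 - x k = \sum_(j < k.+1) ((st k.+1).2 j - (st k).2 j).
    rewrite sumrB; congr (_ - _).
    (* The entry of index [k] is still 0 at stage [k], so [x k] may be summed over [k.+1] terms. *)
    by rewrite big_ord_recr/= ((bi k).2 k (leqnn k)) addr0.
  rewrite (le_trans (rnorm_sum _ _ _))// -dE mulr_natl.
  rewrite -[X in _ *+ X](card_ord k.+1) -sumr_const.
  by apply: ler_sum => j _.
exists m, w, x0; split=> [i j|i|].
- apply: (dual_limit (k0 := (i + j).+1) eta0' q01 (wP j)) => k ijk.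
  rewrite -(mE i k) ?(leq_trans _ ijk) ?ltnS ?leq_addr//.
  by rewrite (bi k).1// (leq_trans _ ijk)// ltnS ?leq_addr ?leq_addl.
- apply: (dual_limit (k0 := i.+1) eta0' q01 x0P) => k ik.
  rewrite /x raddf_sum/= (bigD1 (Ordinal ik))//= -(mE i k)// (bi k).1// eqxx.
  rewrite big1 ?addr0// => j ji; rewrite (bi k).1//.
  by case: eqP => // ij; case/eqP: ji; apply: val_inj.
- by have := x0P 0%N; rewrite /x big_ord0 subr0 expr0 mulr1.
Qed.

(** Otherwise the identity matrix of size [(size s).+1] would factor through dimension [size s]. The
    [y j] allow working modulo a subspace on which all [phi i] vanish. *)
Lemma biorthogonal_not_spanned (V : normedModType R[i]) (s : seq V)
    (phi : nat -> dual V) (p y : nat -> V) :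
  (forall i j, phi i (p j) = (i == j)%:R) -> (forall i j, phi i (y j) = 0) ->
  ~ forall j, linear_span s (p j - y j).
Proof.
move=> phip phiy /choice[c cE].
pose A := \matrix_(i < (size s).+1, k < size s) (c i k : R[i]).
pose B := \matrix_(k < size s, j < (size s).+1) (phi j s`_k : R[i]).
have AB : A *m B = 1%:M.
  apply/matrixP => i j; rewrite !mxE.
  transitivity (phi j (p i - y i) : R[i]); last first.
    by rewrite raddfB/= phip phiy subr0 eq_sym.
  rewrite cE raddf_sum/=; apply: eq_bigr => k _.
  by rewrite !mxE linearZ.
have := mxrankM_maxl A B; rewrite AB mxrank1 leqNgt.
by rewrite ltnS rank_leq_col.
Qed.

End BiorthogonalSystem.

(** * The rank one perturbation and its invariant half-space *)

Theorem theorem4p2 (R : realType) (X : completeNormedModType R[i])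
    (T : bop X X) :
  boundary (spectrum (adjoint T)) `\` point_spectrum (adjoint T) !=set0 ->
  forall eps : R, 0 < eps ->
  exists F : bop X X,
    [/\ rank_one F, `|F| < eps%:C
      & exists2 Y : set X, half_space Y & invariant_subset (T + F) Y].
Proof.
move=> [lam [lamb lamp]] eps eps0.
have [f [mu [h [f0 muP hf hn]]]] := resolvent_orbit (@dual_rate_complete R X) lamb.
have f1 : 0 < rnorm f + 1 by rewrite ltr_wpDl ?rnorm_ge0.
(* The bound [eps / (rnorm f + 1)] on [x0] makes [rnorm f * rnorm x0], which dominates the norm of
   [F], strictly less than [eps]. *)
have [m [w [x0 [mw mx0 x0e]]]] := biorthogonal_system
  (@complete_rate_complete R X) (divr_gt0 eps0 f1) hn (approx_eigen_null lamp muP hf hn).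
have Flin : linear (fun x => (f x : R[i]) *: x0).
  by move=> a x y; rewrite linearP/= scalerDl scalerA.
have Fle x : rnorm ((f x : R[i]) *: x0) <= rnorm f * rnorm x0 * rnorm x.
  rewrite rnormZ mulrAC; apply: ler_pM (rnorm_dual_le _ _) (lexx _); exact: rnorm_ge0.
have [|F FE] := bounded_bop Flin; first by exists (rnorm f * rnorm x0).
exists F; split.
- exists x0; first by apply/eqP => x00; have /eqP := mx0 0%N; rewrite x00 raddf0 eq_sym oner_eq0.
  have [x fx] : exists x, f x != 0.
    apply: contrapT => nx; case/eqP: f0; apply: bop_eqP => x.
    by apply: contrapT => /eqP fx; apply: nx; exists x.
  apply/seteqP; split=> [_ [z _ <-]|_ [z _ <-]]; first by exists (f z); rewrite ?FE.
  exists ((z / f x) *: x) => //; rewrite FE linearZ/=; congr (_ *: _).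
  exact: divfK.
- rewrite rnormE ltcR rnorm_bop.
  apply: (@le_lt_trans _ _ (rnorm f * rnorm x0)).
    apply: opnorm_le_bound; first by rewrite mulr_ge0 ?rnorm_ge0.
    by move=> x; rewrite FE.
  rewrite (le_lt_trans (ler_wpM2l (rnorm_ge0 f) x0e))//.
  by rewrite mulrCA gtr_pMr// ltr_pdivrMr// mul1r ltrDl.
pose Y := [set x : X | forall i, h (m i.*2) x = 0].
exists Y; last first.
  (* As the functional is 1 on [x0], its value at [(T + F) x] is its value at [T x] plus [f x], that
     is [mu] times its value at [x], which is 0. *)
  move=> _ [x Yx <-] i; rewrite bopD raddfD/= FE linearZ/= mx0 [_ *: _]mulr1.
  rewrite (shifted_adjointE (hf (m i.*2))) Yx mulr0 sub0r; exact: subrr.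
split.
- split=> [i|a x y Yx Yy i]; first by rewrite raddf0.
  by rewrite linearP/= Yx Yy [_ *: _]mulr0 addr0.
- move=> x Yx i; apply: rnorm_eq_le => e e0; rewrite subr0.
  have C1 : 0 < rnorm (h (m i.*2)) + 1 by rewrite ltr_wpDl ?rnorm_ge0.
  have e1 : 0 < (e / (rnorm (h (m i.*2)) + 1))%:C by rewrite ltcR divr_gt0.
  have [y [Yy]] := Yx _ (nbhsx_ballx x _ e1).
  rewrite -ball_normE/= rnormE ltcR => xy.
  have -> : h (m i.*2) x = h (m i.*2) (x - y) by rewrite raddfB/= Yy subr0.
  rewrite (le_trans (rnorm_dual_le _ _))//.
  rewrite (le_trans (ler_wpM2l (rnorm_ge0 _) (ltW xy)))//.
  by rewrite mulrCA ler_piMr ?ltW// ltr_pdivrMr// mul1r ltrDl.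
(* The [w j] of odd index lie in [Y] and are separated by the functionals of odd rank. *)
- move=> [s Ys].
  apply: (@biorthogonal_not_spanned R X s (fun i => h (m i.*2.+1))
    (fun j => w j.*2.+1) (fun=> 0)).
  + by move=> i j; rewrite mw eqSS (inj_eq double_inj).
  + by move=> i j; rewrite raddf0.
  + move=> j; rewrite subr0 -Ys => i; rewrite mw.
    by case: eqP => // /(congr1 odd); rewrite /= !odd_double.
(* The functionals of even rank vanish on [Y], so they separate the [w j] of even index modulo
   [Y]. *)
- move=> [s Ys]; have /choice[y yP] j : exists y, Y y /\ linear_span s (w j.*2 - y).
    by have [y ? ?] := Ys (w j.*2); exists y.
  apply: (@biorthogonal_not_spanned R X s (fun i => h (m i.*2))
    (fun j => w j.*2) y).
  + by move=> i j; rewrite mw (inj_eq double_inj).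
  + by move=> i j; have [+ _] := yP j; apply.
  + by move=> j; have [] := yP j.
Qed.
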